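(* Let $n\geq 2$ and let $g$ be chosen from the Haar measure of $O(2n,\mathbb{R})$. Let $W(g)$ be the trace of $g$. Then for all real $x_0$, $$\left| \mathbb{P}(W \leq x_0) - \frac{1}{\sqrt{2 \pi}} \int_{-\infty}^{x_0} e^{-\frac{x^2}{2}}\, dx \right| \leq \frac{\sqrt{2}}{n-1}.$$
   Context: $O(2n,\mathbb{R})$ is the group of $2n\times 2n$ real orthogonal matrices. Haar measure is normalized to be a probability measure. *)

(* Defs.v *)
From HB Require Import structures.
From mathcomp Require Import all_boot all_order all_algebra.
From mathcomp Require Import all_classical all_reals all_analysis.
From mathcomp Require Import measurable_realfun.

Set Implicit Arguments.
Unset Strict Implicit.
Unset Printing Implicit Defensive.

Import Order.TTheory GRing.Theory Num.Theory numFieldNormedType.Exports.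

Local Open Scope classical_set_scope.
Local Open Scope ring_scope.

Definition orthogonal_mx (R : realType) (n : nat) : {pred 'M[R]_n} :=
  fun A => A *m A^T == 1%:M.

Record orthogonal_group (R : realType) (n : nat) := Orthogonal {
  orth_mx :> 'M[R]_n;
  orth_mxP : orth_mx \in @orthogonal_mx R n }.

HB.instance Definition _ (R : realType) (n : nat) :=
  [isSub for @orth_mx R n].
HB.instance Definition _ (R : realType) (n : nat) :=
  [Choice of orthogonal_group R n by <:].

Lemma orthogonal_mx1 (R : realType) (n : nat) : 1%:M \in @orthogonal_mx R n.
Proof. by rewrite unfold_in trmx1 mulmx1. Qed.

Lemma orthogonal_mxM (R : realType) (n : nat) (A B : 'M[R]_n) :
  A \in @orthogonal_mx R n -> B \in @orthogonal_mx R n ->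
  A *m B \in @orthogonal_mx R n.
Proof.
rewrite !unfold_in => /eqP hA /eqP hB.
by rewrite trmx_mul mulmxA -(mulmxA A) hB mulmx1 hA.
Qed.

Lemma orthogonal_mxV (R : realType) (n : nat) (A : 'M[R]_n) :
  A \in @orthogonal_mx R n -> A^T \in @orthogonal_mx R n.
Proof. by rewrite !unfold_in trmxK => /eqP/mulmx1C/eqP. Qed.

Definition orth_one (R : realType) (n : nat) : orthogonal_group R n :=
  Orthogonal (orthogonal_mx1 R n).
Definition orth_mul (R : realType) (n : nat) (g h : orthogonal_group R n) :
  orthogonal_group R n := Orthogonal (orthogonal_mxM (orth_mxP g) (orth_mxP h)).
Definition orth_inv (R : realType) (n : nat) (g : orthogonal_group R n) :
  orthogonal_group R n := Orthogonal (orthogonal_mxV (orth_mxP g)).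

Lemma orth_mulA (R : realType) (n : nat) : associative (@orth_mul R n).
Proof. by move=> f g h; apply: val_inj; rewrite /= mulmxA. Qed.
Lemma orth_mul1g (R : realType) (n : nat) :
  left_id (orth_one R n) (@orth_mul R n).
Proof. by move=> g; apply: val_inj; rewrite /= mul1mx. Qed.
Lemma orth_mulg1 (R : realType) (n : nat) :
  right_id (orth_one R n) (@orth_mul R n).
Proof. by move=> g; apply: val_inj; rewrite /= mulmx1. Qed.
Lemma orth_mulVg (R : realType) (n : nat) :
  left_inverse (orth_one R n) (@orth_inv R n) (@orth_mul R n).
Proof.
move=> g; apply: val_inj => /=; apply: mulmx1C; apply/eqP.
exact: (orth_mxP g).
Qed.

Lemma orth_mulgV (R : realType) (n : nat) :
  right_inverse (orth_one R n) (@orth_inv R n) (@orth_mul R n).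
Proof. by move=> g; apply: val_inj; apply/eqP; exact: (orth_mxP g). Qed.

HB.instance Definition _ (R : realType) (n : nat) :=
  isGroup.Build (orthogonal_group R n) (@orth_mulA R n) (@orth_mul1g R n)
    (@orth_mulg1 R n) (@orth_mulVg R n) (@orth_mulgV R n).
HB.instance Definition _ (R : realType) (n : nat) :=
  isPointed.Build (orthogonal_group R n) (orth_one R n).

HB.instance Definition _ (R : realType) (n : nat) :=
  Topological.copy (orthogonal_group R n) (initial_topology (@orth_mx R n)).
HB.instance Definition _ (R : realType) (n : nat) :=
  Measurable.copy (orthogonal_group R n)
    (g_sigma_algebraType (@open (orthogonal_group R n))).

(* On a compact group the Haar probability is the unique left-invariant Borel
   probability; regularity is automatic, the group being metrizable. *)
Definition is_haar (R : realType) (n : nat)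
    (P : probability (orthogonal_group R n) R) : Prop :=
  forall (g : orthogonal_group R n) (A : set (orthogonal_group R n)),
    measurable A -> P [set (g * h)%g | h in A] = P A.

Lemma continuous_orth_entry (R : realType) (n : nat) (i j : 'I_n) :
  continuous (fun g : orthogonal_group R n => orth_mx g i j).
Proof.
have cf : continuous (@orth_mx R n) by exact: initial_continuous.
move=> g; apply: (@continuous_comp _ _ _ (@orth_mx R n)
  (fun M : 'M[R]_n => M i j)); first exact: cf.
exact: coord_continuous.
Qed.

Lemma measurable_orth_trace (R : realType) (n : nat) :
  measurable_fun setT (fun g : orthogonal_group R n => \tr (orth_mx g)).
Proof.
have ct : continuous (fun g : orthogonal_group R n => \tr (orth_mx g)).
  rewrite /mxtrace; apply: continuous_big => [|i _].
    exact: add_continuous.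
  exact: continuous_orth_entry.
apply: (measurability _ (RGenOpens.measurableE R)) => _ [_ [a [b ->] <-]].
rewrite setTI; apply: sub_sigma_algebra.
by apply: open_comp => // g _; exact: ct.
Qed.

(* Main.v *)
(* Stein's method for the flow of infinitesimal rotations.  Put N = 2n and
   p_k(g) = tr(g^k).  Invariance of Haar measure under the rotations
   exp(t (E_ij - E_ji)) gives an integration by parts formula for each (i, j);
   summing over (i, j) with the quadratic identities for the matrices E_ij - E_ji
   yields, for f of class C^1,
     (N - 1) E[p_1 f(p_1)] = E[(N - p_2) f'(p_1)],
   and five similar relations between the moments of degree 4, which form a
   nonsingular linear system when N > 4 and force E[(p_2 - 1)^2] = 2.  If f solves
   the Stein equation f' - x f = h - E[h(Z)] with 0 <= h <= 1, then |f'| <= 2, so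
     |E[h(p_1)] - E[h(Z)]| = |E[f'(p_1) (p_2 - 1)]| / (N - 1) <= 2 sqrt 2 / (2n - 1),
   which is less than sqrt 2 / (n - 1).  For n = 2 the bound exceeds 1. *)

Require Import Defs.
From HB Require Import structures.
From mathcomp Require Import all_boot all_order all_algebra.
From mathcomp Require Import all_classical all_reals all_analysis.
From mathcomp Require Import measurable_realfun zify ring lra.

Set Implicit Arguments.
Unset Strict Implicit.
Unset Printing Implicit Defensive.

Import Order.TTheory GRing.Theory Num.Theory numFieldNormedType.Exports.

Local Open Scope classical_set_scope.
Local Open Scope ring_scope.

(** * Haar integrals of bounded measurable functions *)

Lemma mulmxl_continuous (R : realType) (m n p : nat) (A : 'M[R]_(m, n)) :
  continuous (mulmx A : 'M[R]_(n, p) -> 'M[R]_(m, p)).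
Proof.
move=> M U [Q MQ QU].
have cf i j : continuous (fun N : 'M[R]_(n, p) => (A *m N) i j).
  under eq_fun do rewrite mxE.
  apply: (@continuous_big R) => [|k _]; first exact: add_continuous.
  move=> N; apply: (@continuousM _ _ (fun=> A i k) (fun N : 'M[R]_(n, p) => N k j)).
    exact: cst_continuous.
  exact: coord_continuous.
(* A basic neighborhood of a matrix constrains finitely many entries, so the entrywise conditions
   hold jointly near [M]. *)
have : \forall N \near M, forall ij : 'I_m * 'I_p, Q ij.1 ij.2 ((A *m N) ij.1 ij.2).
  apply: (@filter_forall _ _ (fun ij N => Q ij.1 ij.2 ((A *m N) ij.1 ij.2)) (nbhs M) _).
  by move=> [i j]; exact: (cf i j M _ (MQ i j)).
by apply: filterS => N QN; apply: QU => i j; exact: (QN (i, j)).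
Qed.

Lemma orth_mul_continuous (R : realType) (n : nat) (g : orthogonal_group R n) :
  continuous (orth_mul g).
Proof.
apply/continuousP => _ [U oU <-].
exists ((mulmx g : 'M[R]_n -> 'M[R]_n) @^-1` U) => //.
by apply: open_comp => // M _; exact: mulmxl_continuous.
Qed.

Lemma measurable_orth_mul (R : realType) (n : nat) (g : orthogonal_group R n) :
  measurable_fun setT (orth_mul g).
Proof.
apply: (measurability (@open (orthogonal_group R n)) erefl) => _ [U oU <-].
rewrite setTI; apply: sub_sigma_algebra.
by apply: open_comp => // h _; exact: orth_mul_continuous.
Qed.

Lemma measurable_orth_entry (R : realType) (n : nat) (i j : 'I_n) :
  measurable_fun setT (fun g : orthogonal_group R n => orth_mx g i j).
Proof.
apply: (measurability _ (RGenOpens.measurableE R)) => _ [_ [a [b ->] <-]].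
rewrite setTI; apply: sub_sigma_algebra.
by apply: open_comp => // g _; exact: continuous_orth_entry.
Qed.

(** This class is stable under ring operations and integrable for every probability, so
    integrability conditions follow from the shape of the integrand. *)
Definition bounded_measurable d (T : measurableType d) (R : realType)
    (F : T -> R) :=
  measurable_fun setT F /\ exists C : R, forall x, `|F x| <= C.

Section bounded_measurable.
Context d (T : measurableType d) (R : realType).
Implicit Types F G : T -> R.

Lemma bmeas_cst (c : R) : bounded_measurable (fun _ : T => c).
Proof. by split; [exact: measurable_cst|exists `|c|]. Qed.

Lemma bmeasD F G : bounded_measurable F -> bounded_measurable G ->
  bounded_measurable (fun x => F x + G x).
Proof.
move=> [mF [C hC]] [mG [D hD]]; split; first exact: measurable_funD.
exists (C + D) => x; exact: le_trans (ler_normD _ _) (lerD (hC x) (hD x)).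
Qed.

Lemma bmeasM F G : bounded_measurable F -> bounded_measurable G ->
  bounded_measurable (fun x => F x * G x).
Proof.
move=> [mF [C hC]] [mG [D hD]]; split; first exact: measurable_funM.
by exists (C * D) => x; rewrite normrM ler_pM.
Qed.

Lemma bmeasN F : bounded_measurable F -> bounded_measurable (fun x => - F x).
Proof.
move=> [mF [C hC]]; split; first exact: measurable_funN.
by exists C => x; rewrite normrN.
Qed.

Lemma bmeasB F G : bounded_measurable F -> bounded_measurable G ->
  bounded_measurable (fun x => F x - G x).
Proof. by move=> bF /bmeasN; exact: bmeasD. Qed.

Lemma bmeasX F (m : nat) :
  bounded_measurable F -> bounded_measurable (fun x => F x ^+ m).
Proof.
move=> bF; elim: m => [|m IHm].
  by under eq_fun do rewrite expr0; exact: bmeas_cst.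
by under eq_fun do rewrite exprS; exact: bmeasM.
Qed.

Lemma bmeas_sum (I : Type) (r : seq I) (F : I -> T -> R) :
  (forall i, bounded_measurable (F i)) ->
  bounded_measurable (fun x => \sum_(i <- r) F i x).
Proof.
move=> bF; elim: r => [|i r IHr].
  by under eq_fun do rewrite big_nil; exact: bmeas_cst.
by under eq_fun do rewrite big_cons; exact: bmeasD.
Qed.

Lemma bmeas_integrable (P : probability T R) F : bounded_measurable F ->
  P.-integrable setT (EFin \o F).
Proof.
move=> [mF [C hC]]; apply: measurable_bounded_integrable => //.
  by rewrite (le_lt_trans (probability_le1 P _)) ?ltry.
exists C; split; first exact: num_real.
by move=> M CM x _; exact: le_trans (hC x) (ltW CM).
Qed.

Section Rintegral.
Variable P : probability T R.

Lemma bmeas_RintegralD F G : bounded_measurable F -> bounded_measurable G ->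
  \int[P]_x (F x + G x) = \int[P]_x F x + \int[P]_x G x.
Proof. by move=> bF bG; rewrite RintegralD//; exact: bmeas_integrable. Qed.

Lemma bmeas_RintegralB F G : bounded_measurable F -> bounded_measurable G ->
  \int[P]_x (F x - G x) = \int[P]_x F x - \int[P]_x G x.
Proof. by move=> bF bG; rewrite RintegralB//; exact: bmeas_integrable. Qed.

Lemma bmeas_RintegralZ (c : R) F : bounded_measurable F ->
  \int[P]_x (c * F x) = c * \int[P]_x F x.
Proof. by move=> bF; rewrite RintegralZl//; exact: bmeas_integrable. Qed.

Lemma bmeas_Rintegral_sum (I : Type) (r : seq I) (F : I -> T -> R) :
  (forall i, bounded_measurable (F i)) ->
  \int[P]_x (\sum_(i <- r) F i x) = \sum_(i <- r) \int[P]_x F i x.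
Proof.
move=> bF; elim: r => [|i r IHr].
  by under eq_Rintegral do rewrite big_nil; rewrite Rintegral_cst// mul0r big_nil.
under eq_Rintegral do rewrite big_cons.
by rewrite bmeas_RintegralD ?IHr ?big_cons//; exact: bmeas_sum.
Qed.

Lemma probability_Rintegral_cst (c : R) : \int[P]_x c = c.
Proof.
rewrite Rintegral_cst// -[RHS]mulr1; congr (_ * _).
by have := probability_setT P => /(congr1 fine).
Qed.

Lemma bmeas_le_Rintegral F G : bounded_measurable F -> bounded_measurable G ->
  (forall x, F x <= G x) -> \int[P]_x F x <= \int[P]_x G x.
Proof. by move=> bF bG FG; apply: le_Rintegral => //; exact: bmeas_integrable. Qed.

End Rintegral.

End bounded_measurable.

Lemma bmeas_orth_mul (R : realType) (n : nat) (g : orthogonal_group R n) F :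
  bounded_measurable F -> bounded_measurable (fun h => F (orth_mul g h) : R).
Proof.
move=> [mF [C hC]]; split; last by exists C => h; exact: hC.
exact: measurableT_comp mF (measurable_orth_mul g).
Qed.

Section bounded_measurable_mx.
Context d (T : measurableType d) (R : realType).

Definition bmeas_mx m n (Z : T -> 'M[R]_(m, n)) :=
  forall k l, bounded_measurable (fun x => Z x k l).

Lemma bmeas_mx_cst m n (A : 'M[R]_(m, n)) : bmeas_mx (fun=> A).
Proof. by move=> k l; exact: bmeas_cst. Qed.

Lemma bmeas_mxM m n p (Y : T -> 'M[R]_(m, n)) (Z : T -> 'M[R]_(n, p)) :
  bmeas_mx Y -> bmeas_mx Z -> bmeas_mx (fun x => Y x *m Z x).
Proof.
move=> bY bZ k l; under eq_fun do rewrite mxE.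
by apply: bmeas_sum => i; exact: bmeasM.
Qed.

Lemma bmeas_mxD m n (Y Z : T -> 'M[R]_(m, n)) :
  bmeas_mx Y -> bmeas_mx Z -> bmeas_mx (fun x => Y x + Z x).
Proof. by move=> bY bZ k l; under eq_fun do rewrite mxE; exact: bmeasD. Qed.

Lemma bmeas_mxZ m n (F : T -> R) (Z : T -> 'M[R]_(m, n)) :
  bounded_measurable F -> bmeas_mx Z -> bmeas_mx (fun x => F x *: Z x).
Proof. by move=> bF bZ k l; under eq_fun do rewrite mxE; exact: bmeasM. Qed.

Lemma bmeas_trmx m n (Z : T -> 'M[R]_(m, n)) :
  bmeas_mx Z -> bmeas_mx (fun x => (Z x)^T).
Proof. by move=> bZ k l; under eq_fun do rewrite mxE; exact: bZ. Qed.

Lemma bmeas_mxX n (Z : T -> 'M[R]_n) (m : nat) :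
  bmeas_mx Z -> bmeas_mx (fun x => Z x ^+ m).
Proof.
move=> bZ; elim: m => [|m IHm].
  by under eq_fun do rewrite expr0; exact: bmeas_mx_cst.
by under eq_fun do rewrite exprS; exact: bmeas_mxM.
Qed.

Lemma bmeas_mxtrace n (Z : T -> 'M[R]_n) :
  bmeas_mx Z -> bounded_measurable (fun x => \tr (Z x)).
Proof. by move=> bZ; apply: bmeas_sum. Qed.

End bounded_measurable_mx.

Section orthogonal_entries.
Context (R : realType) (n : nat).

Lemma orth_mulmx_tr (g : orthogonal_group R n) : orth_mx g *m (orth_mx g)^T = 1%:M.
Proof. by have := orth_mxP g; rewrite unfold_in => /eqP. Qed.

(** Each row of an orthogonal matrix is a unit vector, so the entries lie in [-1, 1]. *)
Lemma bmeas_orth_mx : bmeas_mx (fun g : orthogonal_group R n => orth_mx g).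
Proof.
move=> k l; split; first exact: measurable_orth_entry.
exists 1 => g; rewrite -(@ler_pXn2r _ 2) ?nnegrE// expr1n real_normK ?num_real//.
have := congr1 (fun A : 'M[R]_n => A k k) (orth_mulmx_tr g).
rewrite mxE [RHS]mxE eqxx mulr1n (bigD1 l)//= mxE -expr2 => <-.
rewrite lerDl sumr_ge0// => j _; rewrite mxE -expr2; exact: sqr_ge0.
Qed.

End orthogonal_entries.

Section haar.
Context (R : realType) (n : nat).
Variable P : probability (orthogonal_group R n) R.
Hypothesis hP : is_haar P.

(** Preimages under translation by [g] are images under translation by its inverse, and [is_haar]
    speaks of images. *)
Lemma haar_preimage (g : orthogonal_group R n) (A : set (orthogonal_group R n)) :
  measurable A -> P (orth_mul g @^-1` A) = P A.
Proof.
move=> mA; rewrite -(hP (orth_inv g) mA); congr (P _).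
apply/seteqP; split => [h /= gh|_ [h Ah <-]].
  exists (orth_mul g h) => //; apply: (etrans (orth_mulA _ _ _)).
  by rewrite orth_mulVg orth_mul1g.
suff -> : (orth_mul g @^-1` A) (orth_mul (orth_inv g) h) = A h by [].
by congr A; rewrite orth_mulA orth_mulgV orth_mul1g.
Qed.

(** By [haar_preimage] the pushforward of [P] under a left translation is [P]; the rest is a change
    of variables. *)
Lemma haar_Rintegral (g : orthogonal_group R n) F : bounded_measurable F ->
  \int[P]_h F (orth_mul g h) = \int[P]_h F h.
Proof.
move=> bF; congr fine.
have bFg := bmeas_orth_mul g bF.
transitivity (\int[pushforward P (orth_mul g)]_h (F h)%:E)%E.
  rewrite integral_pushforward//; first exact: measurable_orth_mul.
    by apply/measurable_EFinP; case: bF.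
  exact: bmeas_integrable.
apply: eq_measure_integral => [|mphi A mA _]; first exact: measurable_orth_mul.
exact: (haar_preimage g mA).
Qed.

End haar.

(** * Derivatives along rotations *)

(** Dominated convergence will be applied to a sequence, so the derivative at 0 is read along the
    steps 1/(k + 1). *)
Lemma is_derive_cvg_seq (R : realType) (f : R -> R) (df : R) :
  is_derive (0 : R) 1 f df ->
  (fun k => k.+1%:R * (f k.+1%:R^-1 - f 0)) @ \oo --> df.
Proof.
move=> [dv <-].
have dn : (fun k => k.+1%:R^-1 : R) @ \oo --> (0 : R)^'.
  move=> A [e /= e0 eA]; have := @cvg_harmonic R.
  move/cvgrPdist_lt => /(_ e e0); apply: filterS => k hk; apply: eA => //=.
have := cvg_comp _ _ dn dv; apply: cvg_trans; apply: near_eq_cvg.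
by apply: nearW => k; rewrite /= invrK /shift /= addr0 [_ *: 1]mulr1.
Qed.

Lemma is_derive_lipschitz (R : realType) (f df : R -> R) (C : R) :
  (forall t : R, is_derive t 1 f (df t)) -> (forall t, `|df t| <= C) ->
  forall s t, `|f s - f t| <= C * `|s - t|.
Proof.
move=> fdf dfC s t; wlog ts : s t / t <= s.
  move=> H; have [/H//|/ltW/H] := leP t s.
  by rewrite distrC (distrC s).
have [|c _ ->] := @MVT_segment R f df t s ts (fun x _ => fdf x).
  by apply: derivable_within_continuous => x _; by have [] := fdf x.
by rewrite normrM ler_wpM2r.
Qed.

Lemma is_derive_continuous (R : realType) (f df : R -> R) :
  (forall t : R, is_derive t 1 f (df t)) -> continuous f.
Proof.
move=> fdf t; apply/differentiable_continuous/derivable1_diffP.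
by case: (fdf t).
Qed.

Section rotation.
Context (R : realType) (n : nat).
Implicit Types (i j : 'I_n) (s t : R) (F H : orthogonal_group R n -> R).

(** The generator of the rotations in the plane of the basis vectors [i] and [j]. It vanishes for
    [i = j], so sums may run over all pairs. *)
Definition skew_mx i j : 'M[R]_n := delta_mx i j - delta_mx j i.

Lemma tr_skew i j : (skew_mx i j)^T = - skew_mx i j.
Proof. by rewrite /skew_mx linearB /= !trmx_delta opprB. Qed.

(** For distinct indices the matrix is a quarter turn of its plane, so its square is minus the
    projection onto that plane. *)
Lemma skewX3 i j : skew_mx i j *m skew_mx i j *m skew_mx i j = - skew_mx i j.
Proof.
rewrite /skew_mx; have [->|ij] := eqVneq i j; first by rewrite subrr mulmx0 oppr0.
have ji : j != i by rewrite eq_sym.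
rewrite !(mulmxBl, mulmxBr, mul_delta_mx_cond, eqxx, negbTE ij, negbTE ji,
  mul0mx, mulr1n, mulr0n, mulmx0, subr0, sub0r, mulNmx, mulmxN, opprK, opprB).
by rewrite addrC.
Qed.

(** Rodrigues' formula for exp(t A) with A = [skew_mx i j]: the relation A^3 = -A folds the
    exponential series into these three terms. *)
Definition rot_mx i j t : 'M[R]_n :=
  1%:M + sin t *: skew_mx i j + (1 - cos t) *: (skew_mx i j *m skew_mx i j).

Lemma rot_mxP i j t : rot_mx i j t \in @orthogonal_mx R n.
Proof.
rewrite unfold_in /rot_mx.
move: (skew_mx i j) (tr_skew i j) (skewX3 i j) => A trA A3.
set s := sin t; set c := 1 - cos t.
(* This is sin^2 t = (1 - cos t)(1 + cos t). It cancels the coefficient of A^2 in the product of the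
   rotation and its transpose. *)
have sc : s ^+ 2 = 2 * c - c ^+ 2.
  by rewrite /s /c; have := cos2Dsin2 t; nra.
have trB : (A *m A)^T = A *m A by rewrite trmx_mul trA mulmxN mulNmx opprK.
have AB : A *m (A *m A) = - A by rewrite mulmxA.
have BB : A *m A *m (A *m A) = - (A *m A) by rewrite mulmxA A3 mulNmx.
have [B AA] : exists B, A *m A = B by exists (A *m A).
rewrite !AA in trB A3 AB BB *.
have -> : (1%:M + s *: A + c *: B)^T = 1%:M - s *: A + c *: B.
  by rewrite !linearD /= !linearZ /= trmx1 trA trB scalerN.
rewrite !(mulmxDl, mulmxDr, mul1mx, mulmx1, mulNmx, mulmxN).
rewrite -!(scalemxAl, scalemxAr) AA AB A3 BB !scalerN !scalerA opprK.
rewrite -(expr2 s) sc; apply/eqP/matrixP => k l; rewrite !mxE.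
by move: (_ *+ _) (A k l) (B k l) => x y z; ring.
Qed.

Definition rot i j t : orthogonal_group R n := Orthogonal (rot_mxP i j t).

Lemma rot0 i j g : orth_mul (rot i j 0) g = g.
Proof.
apply: val_inj => /=.
by rewrite /rot_mx sin0 cos0 subrr !scale0r !addr0 mul1mx.
Qed.

(** The derivative is asked for along the whole orbit, not only at t = 0, so that the mean value
    theorem bounds increments by the supremum of [F']. *)
Definition lie_derive i j F F' := forall g t,
  is_derive t 1 (fun s => F (orth_mul (rot i j s) g))
    (F' (orth_mul (rot i j t) g)).

Lemma lie_derive_eq i j F F1 F2 : F1 =1 F2 ->
  lie_derive i j F F1 -> lie_derive i j F F2.
Proof. by move=> /funext ->. Qed.

Lemma lie_derive_cst i j c : lie_derive i j (fun=> c) (fun=> 0).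
Proof. by move=> g t; exact: is_derive_cst. Qed.

Lemma lie_deriveM i j F F' H H' : lie_derive i j F F' -> lie_derive i j H H' ->
  lie_derive i j (fun g => F g * H g) (fun g => F g * H' g + H g * F' g).
Proof. by move=> dF dH g t; exact: is_deriveM. Qed.

Lemma lie_derive_sum i j m (F F' : 'I_m -> orthogonal_group R n -> R) :
  (forall k, lie_derive i j (F k) (F' k)) ->
  lie_derive i j (fun g => \sum_k F k g) (fun g => \sum_k F' k g).
Proof.
move=> dF g t; have := @is_derive_sum _ _ _ m _ t 1 _ (fun k => dF k g t).
by rewrite fct_sumE.
Qed.

Lemma lie_derive_comp i j (f f' : R -> R) F F' :
  (forall x : R, is_derive x 1 f (f' x)) -> lie_derive i j F F' ->
  lie_derive i j (fun g => f (F g)) (fun g => f' (F g) * F' g).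
Proof. by move=> df dF g t; exact: is_derive1_comp. Qed.

(** The derivative of exp(t A) is A exp(t A): by A^3 = -A, both equal (cos t) A + (sin t) A^2. *)
Lemma lie_derive_entry i j (k l : 'I_n) :
  lie_derive i j (fun g => orth_mx g k l) (fun g => (skew_mx i j *m orth_mx g) k l).
Proof.
move=> g t; rewrite /= /rot_mx; move: (skew_mx i j) (skewX3 i j) => A A3.
have -> : (fun s => ((1%:M + sin s *: A + (1 - cos s) *: (A *m A)) *m g) k l) =
  (fun s => g k l + sin s * (A *m g) k l + (1 - cos s) * (A *m A *m g) k l).
  apply/funext => s; rewrite !mulmxDl mul1mx -!scalemxAl.
  by move: (A *m g) (A *m A *m g) => X Y; rewrite !mxE.
have -> : (A *m ((1%:M + sin t *: A + (1 - cos t) *: (A *m A)) *m g)) k l =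
  cos t * (A *m g) k l + sin t * (A *m A *m g) k l.
  rewrite !mulmxDl mul1mx -!scalemxAl !mulmxDr -!scalemxAr !mulmxA A3.
  by rewrite mulNmx; move: (A *m g) (A *m A *m g) => X Y; rewrite !mxE; ring.
apply: is_derive_eq; rewrite /GRing.scale /=; ring.
Qed.

(** Invariance gives every difference quotient of [F] along the rotation integral zero. The mean
    value theorem bounds the quotients by the bound [D] of [F'], and dominated convergence passes to
    the limit. *)
Lemma lie_derive_Rintegral (P : probability (orthogonal_group R n) R) :
  is_haar P -> forall i j F F', lie_derive i j F F' ->
  bounded_measurable F -> bounded_measurable F' -> \int[P]_g F' g = 0.
Proof.
move=> hP i j F F' dF bF bF'.
have [mF [C hC]] := bF; have [mF' [D hD]] := bF'.
pose u k g := k.+1%:R * (F (orth_mul (rot i j k.+1%:R^-1) g) - F g).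
have bFr k : bounded_measurable (fun g => F (orth_mul (rot i j k.+1%:R^-1) g)).
  exact: bmeas_orth_mul.
have bFB k := bmeasB (bFr k) bF.
have bu k : bounded_measurable (u k) by apply: bmeasM (bFB k); exact: bmeas_cst.
have u0 k : \int[P]_g u k g = 0.
  by rewrite bmeas_RintegralZ// bmeas_RintegralB// haar_Rintegral// subrr mulr0.
have uD k g : `|u k g| <= D.
  rewrite normrM ger0_norm// -ler_pdivlMl//.
  have := is_derive_lipschitz (dF g) (fun t => hD _) k.+1%:R^-1 0.
  by rewrite rot0 subr0 (ger0_norm (_ : 0 <= k.+1%:R^-1)) 1?mulrC.
have uF g : (fun k => u k g) @ \oo --> F' g.
  have := is_derive_cvg_seq (dF g 0); by rewrite rot0.
have [] := @dominated_convergence _ _ _ P _ (@measurableT _ _)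
  (fun k g => (u k g)%:E) (fun g => (F' g)%:E) (fun=> D%:E).
- by move=> k; apply/measurable_EFinP; case: (bu k).
- exact/measurable_EFinP.
- by apply: aeW => g _; apply: cvg_EFin; [exact: nearW|exact: uF].
- apply: (@bmeas_integrable _ _ _ P (fun=> D)); exact: bmeas_cst.
- by apply: aeW => g k _; rewrite lee_fin.
move=> _ _; rewrite [X in X @ _](_ : _ = fun=> 0%E).
  by move/cvg_lim => /(_ (@ereal_hausdorff _)) h; rewrite /Rintegral -h lim_cst.
apply/funext => k; rewrite -[LHS]fineK; first by congr EFin; exact: u0.
by apply: integrable_fin_num => //; exact: bmeas_integrable.
Qed.

End rotation.

(** * Quadratic identities for the rotation generators *)

Section skew_sums.
Context (R : realType) (n : nat).
Implicit Types (i j k l : 'I_n) (X Y : 'M[R]_n).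

Lemma mulmx_skewE i j X Y k l :
  (X *m skew_mx R i j *m Y) k l = X k i * Y j l - X k j * Y i l.
Proof.
have deltaE a b : (X *m delta_mx a b *m Y) k l = X k a * Y b l.
  rewrite -mulmxA mxE (bigD1 a)//= big1 ?addr0 => [|c ca].
    rewrite mxE (bigD1 b)//= big1 ?addr0 => [|c cb].
      by rewrite mxE !eqxx mul1r.
    by rewrite mxE (negbTE cb) andbF mul0r.
  by rewrite [X in _ * X]mxE big1 ?mulr0// => e _; rewrite mxE (negbTE ca) mul0r.
by rewrite mulmxBr mulmxBl mxE [X in _ + X]mxE !deltaE.
Qed.

Lemma mxtrace_skew i j X : \tr (skew_mx R i j *m X) = X j i - X i j.
Proof.
rewrite -[skew_mx R i j]mul1mx /mxtrace.
under eq_bigr do rewrite mulmx_skewE !mxE.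
rewrite sumrB (bigD1 i)//= big1 ?addr0 => [|c ci].
  rewrite eqxx mul1r (bigD1 j)//= big1 ?addr0 => [|c cj].
    by rewrite eqxx mul1r.
  by rewrite (negbTE cj) mul0r.
by rewrite (negbTE ci) mul0r.
Qed.

(** Each factor is an entry difference, such as [X j i - X i j]. Products of entries at equal
    positions sum to the trace against the transpose, and products at opposite positions to the
    trace of the product. *)
Lemma sum_mxtrace_skewM X Y :
  \sum_i \sum_j \tr (skew_mx R i j *m X) * \tr (skew_mx R i j *m Y) =
  2 * (\tr (X *m Y^T) - \tr (X *m Y)).
Proof.
under eq_bigr do under eq_bigr do rewrite !mxtrace_skew.
have trT : \tr (X *m Y^T) = \sum_i \sum_j X i j * Y i j.
  by apply: eq_bigr => i _; rewrite mxE; apply: eq_bigr => j _; rewrite mxE.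
have tr : \tr (X *m Y) = \sum_i \sum_j X i j * Y j i.
  by apply: eq_bigr => i _; rewrite mxE.
transitivity (\sum_i \sum_j (X j i * Y j i + X i j * Y i j
    - (X j i * Y i j + X i j * Y j i))).
  by apply: eq_bigr => i _; apply: eq_bigr => j _; ring.
under eq_bigr do rewrite sumrB !big_split /=.
rewrite sumrB !big_split /= -tr -trT exchange_big /= -trT.
by rewrite [X in _ - (X + _)]exchange_big /= -tr; ring.
Qed.

(** This evaluates the second-order terms of integration by parts: the products of two diagonal
    entries sum to the product of the traces. *)
Lemma sum_mxtrace_skew_skew X Y :
  \sum_i \sum_j \tr (skew_mx R i j *m (X *m skew_mx R i j *m Y)) =
  2 * (\tr (X *m Y^T) - \tr X * \tr Y).
Proof.
under eq_bigr do under eq_bigr do rewrite mxtrace_skew !mulmx_skewE.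
have trT : \tr (X *m Y^T) = \sum_i \sum_j X i j * Y i j.
  by apply: eq_bigr => i _; rewrite mxE; apply: eq_bigr => j _; rewrite mxE.
have tr : \tr X * \tr Y = \sum_i \sum_j X i i * Y j j.
  by rewrite mulr_suml; apply: eq_bigr => i _; rewrite mulr_sumr.
transitivity (\sum_i \sum_j (X j i * Y j i + X i j * Y i j
    - (X j j * Y i i + X i i * Y j j))).
  by apply: eq_bigr => i _; apply: eq_bigr => j _; ring.
under eq_bigr do rewrite sumrB !big_split /=.
rewrite sumrB !big_split /= -tr -trT exchange_big /= -trT.
by rewrite [X in _ - (X + _)]exchange_big /= -tr; ring.
Qed.

End skew_sums.

(** * Gradients along all rotations *)

Section gradient.
Context (R : realType) (n : nat).
Implicit Types (i j k l : 'I_n) (F H : orthogonal_group R n -> R).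
Implicit Types (X Y Z : orthogonal_group R n -> 'M[R]_n).

Definition lie_derive_mx i j Z Z' :=
  forall k l, lie_derive i j (fun g => Z g k l) (fun g => Z' g k l).

Lemma lie_derive_mx_id i j :
  lie_derive_mx i j (fun g => orth_mx g) (fun g => skew_mx R i j *m orth_mx g).
Proof. by move=> k l; exact: lie_derive_entry. Qed.

Lemma lie_derive_mx_cst i j (A : 'M[R]_n) :
  lie_derive_mx i j (fun=> A) (fun=> 0).
Proof.
move=> k l; apply: lie_derive_eq (lie_derive_cst i j (A k l)).
by move=> g; rewrite mxE.
Qed.

Lemma lie_derive_mxM i j X X' Y Y' :
  lie_derive_mx i j X X' -> lie_derive_mx i j Y Y' ->
  lie_derive_mx i j (fun g => X g *m Y g)
    (fun g => X g *m Y' g + X' g *m Y g).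
Proof.
move=> dX dY k l.
rewrite (_ : (fun g => (X g *m Y g) k l) = fun g => \sum_m X g k m * Y g m l);
  last by apply/funext => g; rewrite mxE.
apply: lie_derive_eq (lie_derive_sum (fun m => lie_deriveM (dX k m) (dY m l))).
move=> g; rewrite mxE [X in _ = X + _]mxE [X in _ = _ + X]mxE -big_split /=.
by apply: eq_bigr => m _; congr (_ + _); rewrite mulrC.
Qed.

Lemma lie_derive_mxtrace i j X X' : lie_derive_mx i j X X' ->
  lie_derive i j (fun g => \tr (X g)) (fun g => \tr (X' g)).
Proof. by move=> dX; apply: lie_derive_sum => k; exact: dX. Qed.

(* [Y g] is only determined up to its symmetric part. *)
Definition is_gradient F Y := forall i j,
  lie_derive i j F (fun g => \tr (skew_mx R i j *m Y g)).

Lemma gradient_cst c : is_gradient (fun=> c) (fun=> 0).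
Proof.
move=> i j; apply: lie_derive_eq (lie_derive_cst i j c) => g.
by rewrite mulmx0 mxtrace0.
Qed.

Lemma gradientM F Y H Z : is_gradient F Y -> is_gradient H Z ->
  is_gradient (fun g => F g * H g) (fun g => F g *: Z g + H g *: Y g).
Proof.
move=> dF dH i j; apply: lie_derive_eq (lie_deriveM (dF i j) (dH i j)) => g.
by rewrite mulmxDr -!scalemxAr mxtraceD !mxtraceZ.
Qed.

Lemma gradient_comp (f f' : R -> R) F Y :
  (forall x : R, is_derive x 1 f (f' x)) -> is_gradient F Y ->
  is_gradient (fun g => f (F g)) (fun g => f' (F g) *: Y g).
Proof.
move=> df dF i j; apply: lie_derive_eq (lie_derive_comp df (dF i j)) => g.
by rewrite -scalemxAr mxtraceZ.
Qed.

Lemma gradient_mxtraceX (m : nat) :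
  is_gradient (fun g => \tr (orth_mx g ^+ m))
    (fun g => m%:R *: orth_mx g ^+ m).
Proof.
move=> i j.
(* The derivative of g^m is a sum of words g^a A g^(m - a), which do not simplify before the trace
   is taken. The extra factor g^r lets the induction peel off one g at a time and close by cyclicity
   of the trace. *)
suff [Z' dZ' trZ'] : exists2 Z',
    lie_derive_mx i j (fun g => orth_mx g ^+ m) Z' &
    forall r g, \tr (orth_mx g ^+ r *m Z' g) =
      m%:R * \tr (skew_mx R i j *m orth_mx g ^+ (m + r)).
  apply: lie_derive_eq (lie_derive_mxtrace dZ') => g.
  have := trZ' 0 g; rewrite expr0 mul1mx addn0 => ->.
  by rewrite -scalemxAr mxtraceZ.
elim: m => [|m [Z' dZ' trZ']].
  exists (fun=> 0); first exact: lie_derive_mx_cst.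
  by move=> r g; rewrite mulmx0 mxtrace0 mul0r.
exists (fun g => orth_mx g *m Z' g + skew_mx R i j *m orth_mx g *m orth_mx g ^+ m).
  under eq_fun do rewrite exprS.
  exact: lie_derive_mxM (lie_derive_mx_id i j) dZ'.
move=> r g; rewrite mulmxDr mxtraceD mulmxA.
have -> : orth_mx g ^+ r *m orth_mx g = orth_mx g ^+ r.+1 by rewrite exprSr.
rewrite trZ' [X in _ + X]mxtrace_mulC -!mulmxA.
have -> : orth_mx g *m (orth_mx g ^+ m *m orth_mx g ^+ r) = orth_mx g ^+ (m.+1 + r).
  by rewrite exprD exprS -mulrA.
by rewrite addnS addSn -[m.+1%:R]natr1 mulrDl mul1r.
Qed.

End gradient.

(** * Integration by parts *)

Definition power_trace (R : realType) (n k : nat) (g : orthogonal_group R n) : R :=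
  \tr (orth_mx g ^+ k).

Local Notation p := power_trace.

Ltac bmeas := repeat first [assumption | exact: bmeas_orth_mx | exact: bmeas_cst
  | apply: bmeasD | apply: bmeasN | apply: bmeasM | apply: bmeasX
  | apply: bmeas_mxtrace | apply: bmeas_trmx | apply: bmeas_mxM | apply: bmeas_mxX
  | apply: bmeas_mxZ | apply: bmeas_mxD].

Section haar_ibp.
Context (R : realType) (n : nat).
Variable P : probability (orthogonal_group R n) R.
Hypothesis hP : is_haar P.

(** The derivative of [F g * \tr (skew_mx R i j *m Z g)] along each rotation has integral zero.
    After summation over the pairs, the products of first derivatives contract by
    [sum_mxtrace_skewM]. *)
Lemma haar_ibp F Y Z Z' : is_gradient F Y -> bounded_measurable F -> bmeas_mx Y ->
  bmeas_mx Z -> (forall i j, lie_derive_mx i j Z (Z' i j)) ->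
  (forall i j, bmeas_mx (Z' i j)) ->
  \int[P]_g (2 * (\tr (Y g *m (Z g)^T) - \tr (Y g *m Z g)) +
    F g * \sum_i \sum_j \tr (skew_mx R i j *m Z' i j g)) = 0.
Proof.
move=> dF bF bY bZ dZ bZ'.
pose G i j g := F g * \tr (skew_mx R i j *m Z' i j g) +
  \tr (skew_mx R i j *m Z g) * \tr (skew_mx R i j *m Y g).
have bS i j X : bmeas_mx X -> bounded_measurable (fun g => \tr (skew_mx R i j *m X g)).
  by move=> bX; apply/bmeas_mxtrace/bmeas_mxM => //; exact: bmeas_mx_cst.
have bG i j : bounded_measurable (G i j).
  by apply: bmeasD; apply: bmeasM => //; exact: bS.
have G0 i j : \int[P]_g G i j g = 0.
  have dH : lie_derive i j (fun g => \tr (skew_mx R i j *m Z g))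
      (fun g => \tr (skew_mx R i j *m Z' i j g)).
    have := lie_derive_mxtrace (lie_derive_mxM
      (@lie_derive_mx_cst R n i j (skew_mx R i j)) (dZ i j)).
    by apply: lie_derive_eq => g; rewrite mul0mx addr0.
  apply: (lie_derive_Rintegral hP (lie_deriveM (dF i j) dH)) => //; last exact: bG.
  by apply: bmeasM => //; exact: bS.
transitivity (\int[P]_g \sum_i \sum_j G i j g).
  apply: eq_Rintegral => g _; rewrite -sum_mxtrace_skewM.
  under [RHS]eq_bigr do rewrite big_split /=.
  rewrite big_split /= [LHS]addrC; congr (_ + _).
    by rewrite mulr_sumr; apply: eq_bigr => i _; rewrite mulr_sumr.
  by apply: eq_bigr => i _; apply: eq_bigr => j _; rewrite mulrC.
rewrite bmeas_Rintegral_sum => [|i]; last by apply: bmeas_sum => j.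
by rewrite big1// => i _; rewrite bmeas_Rintegral_sum// big1.
Qed.

Lemma haar_ibp1 F Y : is_gradient F Y -> bounded_measurable F -> bmeas_mx Y ->
  \int[P]_g (\tr (Y g *m (orth_mx g ^+ 1)^T) - \tr (Y g *m orth_mx g ^+ 1)
    - (n%:R - 1) * (F g * p 1 g)) = 0.
Proof.
under eq_Rintegral do rewrite /power_trace expr1.
move=> dF bF bY.
have bg := @bmeas_orth_mx R n.
have bt : bounded_measurable (fun g : orthogonal_group R n => \tr (orth_mx g)).
  exact: bmeas_mxtrace.
have bA i j : bmeas_mx (fun g : orthogonal_group R n => skew_mx R i j *m orth_mx g).
  by apply: bmeas_mxM => //; exact: bmeas_mx_cst.
have := haar_ibp dF bF bY bg (@lie_derive_mx_id R n) bA.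
set I := (X in _ -> X = 0) => h.
suff : 2 * I = 0 by lra.
rewrite -h -bmeas_RintegralZ; last by bmeas.
apply: eq_Rintegral => g _.
(* The squares of the generators sum to -2 (n - 1) times the identity. *)
have -> : \sum_i \sum_j \tr (skew_mx R i j *m (skew_mx R i j *m orth_mx g)) =
    2 * ((1 - n%:R) * \tr (orth_mx g)).
  transitivity (2 * (\tr (1%:M *m (orth_mx g)^T) -
      \tr (1%:M : 'M[R]_n) * \tr (orth_mx g))).
    rewrite -sum_mxtrace_skew_skew.
    by apply: eq_bigr => i _; apply: eq_bigr => j _; rewrite mul1mx.
  by rewrite mul1mx mxtrace_tr mxtrace1; ring.
ring.
Qed.

(** Here the field is Z = g^2, whose derivative is g A g + A g^2. The first term produces n - p_1^2,
    the second -(n - 1) p_2. *)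
Lemma haar_ibp2 F Y : is_gradient F Y -> bounded_measurable F -> bmeas_mx Y ->
  \int[P]_g (\tr (Y g *m (orth_mx g ^+ 2)^T) - \tr (Y g *m orth_mx g ^+ 2)
    + F g * (n%:R - p 1 g ^+ 2) - (n%:R - 1) * (F g * p 2 g)) = 0.
Proof.
under eq_Rintegral do rewrite /power_trace expr1.
move=> dF bF bY.
have bg := @bmeas_orth_mx R n.
have dg := @lie_derive_mx_id R n.
have bA i j : bmeas_mx (fun g : orthogonal_group R n =>
    orth_mx g *m (skew_mx R i j *m orth_mx g) +
    skew_mx R i j *m orth_mx g *m orth_mx g).
  have bA : bmeas_mx (fun g : orthogonal_group R n => skew_mx R i j *m orth_mx g).
    by apply: bmeas_mxM => //; exact: bmeas_mx_cst.
  by apply: bmeas_mxD; exact: bmeas_mxM.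
have := haar_ibp dF bF bY (bmeas_mxM bg bg)
  (fun i j => lie_derive_mxM (dg i j) (dg i j)) bA.
set I := (X in _ -> X = 0) => h.
suff : 2 * I = 0 by lra.
rewrite -h -bmeas_RintegralZ; last by bmeas.
apply: eq_Rintegral => g _.
have g2 : orth_mx g ^+ 2 = orth_mx g *m orth_mx g by rewrite expr2.
have -> : \sum_i \sum_j \tr (skew_mx R i j *m (orth_mx g *m (skew_mx R i j *m orth_mx g)
      + skew_mx R i j *m orth_mx g *m orth_mx g)) =
    2 * (n%:R - \tr (orth_mx g) ^+ 2 + (1 - n%:R) * \tr (orth_mx g ^+ 2)).
  transitivity (
    \sum_i \sum_j \tr (skew_mx R i j *m (orth_mx g *m skew_mx R i j *m orth_mx g))
    + \sum_i \sum_j \tr (skew_mx R i j *m (1%:M *m skew_mx R i j *m (orth_mx g ^+ 2)))).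
    rewrite -big_split /=; apply: eq_bigr => i _.
    rewrite -big_split /=; apply: eq_bigr => j _.
    by rewrite mulmxDr mxtraceD g2 mul1mx !mulmxA.
  rewrite !sum_mxtrace_skew_skew orth_mulmx_tr mul1mx mxtrace_tr mxtrace1; ring.
rewrite g2; ring.
Qed.

End haar_ibp.

(** * Moments of power traces *)

Section haar_moments.
Context (R : realType) (n : nat).
Variable P : probability (orthogonal_group R n) R.
Hypothesis hP : is_haar P.

Local Notation M := (n%:R - 1 : R).

Lemma power_trace0 (g : orthogonal_group R n) : p 0 g = n%:R.
Proof. by rewrite /power_trace expr0 mxtrace1. Qed.

Lemma mxtrace_orthX_tr (g : orthogonal_group R n) (a b : nat) :
  \tr (orth_mx g ^+ (a + b) *m (orth_mx g ^+ b)^T) = p a g.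
Proof.
congr (\tr _); elim: b => [|b IHb]; first by rewrite addn0 expr0 trmx1 mulmx1.
rewrite addnS !exprSr trmx_mul -mulmxA.
by rewrite [X in _ *m X]mulmxA orth_mulmx_tr mul1mx.
Qed.

Lemma mxtrace_orthX_tr' (g : orthogonal_group R n) (a b : nat) :
  \tr (orth_mx g ^+ b *m (orth_mx g ^+ (a + b))^T) = p a g.
Proof. by rewrite -mxtrace_tr trmx_mul trmxK mxtrace_orthX_tr. Qed.

Lemma mxtrace_orthX_mul (g : orthogonal_group R n) (a b : nat) :
  \tr (orth_mx g ^+ a *m orth_mx g ^+ b) = p (a + b)%N g.
Proof. by rewrite /power_trace exprD. Qed.

Lemma gradient_mxtrace :
  is_gradient (fun g : orthogonal_group R n => p 1 g) (fun g => orth_mx g ^+ 1).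
Proof.
have := @gradient_mxtraceX R n 1.
rewrite (_ : (fun g => _ *: _) = fun g => orth_mx g ^+ 1) //.
by apply/funext => g; rewrite scale1r.
Qed.

(** This is integration by parts for f(p_1), whose gradient is f'(p_1) g. Replacing p_2 by 1 would
    give the Gaussian identity E[f'(W)] = E[W f(W)], so the error is governed by the fluctuations of
    p_2. *)
Lemma haar_stein (f f' : R -> R) : (forall x : R, is_derive x 1 f (f' x)) ->
  bounded_measurable (fun g : orthogonal_group R n => f (p 1 g)) ->
  bounded_measurable (fun g : orthogonal_group R n => f' (p 1 g)) ->
  \int[P]_g (f' (p 1 g) * (n%:R - p 2 g) - M * (f (p 1 g) * p 1 g)) = 0.
Proof.
move=> df bf bf'.
have := haar_ibp1 hP (gradient_comp df gradient_mxtrace) bf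
  ltac:(bmeas).
move=> <-; apply: eq_Rintegral => g _.
rewrite -!scalemxAl !mxtraceZ.
by rewrite (mxtrace_orthX_tr _ 0 1) mxtrace_orthX_mul power_trace0; ring.
Qed.

Lemma bmeas_p k : bounded_measurable (@p R n k).
Proof. by bmeas. Qed.

Lemma haar_moments2 : (4 < n)%N ->
  \int[P]_g (p 1 g ^+ 2) = 1 /\ \int[P]_g p 2 g = 1.
Proof.
rewrite -(ltr_nat R) => n4.
have b1 := bmeas_p 1; have b2 := bmeas_p 2.
(* Taking f = id, and then F = 1 in [haar_ibp2], gives two linear equations for the two means, with
   determinant a multiple of n (n - 2). *)
have e1 : \int[P]_g (n%:R + (- 1) * p 2 g + (- M) * (p 1 g ^+ 2)) = 0.
  have := haar_stein (fun x => is_derive_id x 1) b1 (bmeas_cst _ 1).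
  by move=> <-; apply: eq_Rintegral => g _; ring.
have e2 : \int[P]_g (n%:R + (- M) * p 2 g + (- 1) * (p 1 g ^+ 2)) = 0.
  have := haar_ibp2 hP (@gradient_cst R n 1) (bmeas_cst _ 1)
    (@bmeas_mx_cst _ _ _ _ _ 0).
  move=> <-; apply: eq_Rintegral => g _; rewrite !mul0mx mxtrace0; ring.
move: e1 e2; rewrite !bmeas_RintegralD; [|by bmeas..].
rewrite !bmeas_RintegralZ; [|by bmeas..].
rewrite probability_Rintegral_cst.
move: (\int[P]_x p 2 x) (\int[P]_x (p 1 x ^+ 2)) => y x e1 e2.
have /eqP : (n%:R - 2) * (x - y) = 0 by lra.
rewrite mulf_eq0 subr_eq0 gt_eqF/=; last by lra.
rewrite subr_eq0 => /eqP xy.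
have /eqP : n%:R * (1 - y) = 0 by lra.
rewrite mulf_eq0 gt_eqF/=; last by lra.
by rewrite subr_eq0 xy => /eqP <-.
Qed.

Lemma haar_variance_p2 : (4 < n)%N -> \int[P]_g ((p 2 g - 1) ^+ 2) = 2.
Proof.
move=> n4; have [E11 E2] := haar_moments2 n4.
have b1 := bmeas_p 1; have b2 := bmeas_p 2; have b3 := bmeas_p 3; have b4 := bmeas_p 4.
have G1 := gradient_mxtrace.
have G2 := @gradient_mxtraceX R n 2.
have G3 := @gradient_mxtraceX R n 3.
(* When p_k has weight k, integration by parts closes up on the monomials of weight 4. The five
   relations have as unknowns the means of p_4, p_1 p_3, p_2^2, p_1^2 p_2 and p_1^4. *)
have ec : \int[P]_g (3 * p 2 g + (- 3) * p 4 g + (- M) * (p 1 g * p 3 g)) = 0.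
  have := haar_ibp1 hP G3 b3 ltac:(by bmeas).
  move=> <-; apply: eq_Rintegral => g _.
  rewrite -!scalemxAl !mxtraceZ mxtrace_orthX_mul (mxtrace_orthX_tr _ 2 1).
  by rewrite -/(p 3 g); ring.
have ed : \int[P]_g (2 * (p 1 g ^+ 2) + (- 2) * (p 1 g * p 3 g) + n%:R * p 2 g
    + (- 1) * (p 2 g ^+ 2) + (- M) * (p 1 g ^+ 2 * p 2 g)) = 0.
  have := haar_ibp1 hP (gradientM G1 G2) (bmeasM b1 b2) ltac:(by bmeas).
  move=> <-; apply: eq_Rintegral => g _.
  rewrite !mulmxDl !mxtraceD -!scalemxAl !mxtraceZ !mxtrace_orthX_mul.
  rewrite (mxtrace_orthX_tr _ 1 1) (mxtrace_orthX_tr _ 0 1) power_trace0.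
  by rewrite -/(p 1 g) -/(p 2 g); ring.
have ee : \int[P]_g (3 * n%:R * (p 1 g ^+ 2) + (- 3) * (p 1 g ^+ 2 * p 2 g)
    + (- M) * (p 1 g ^+ 4)) = 0.
  have dX (x : R) : is_derive x 1 (fun x : R => x ^+ 3) (3 * x ^+ 2).
    by apply: is_derive_eq; rewrite /GRing.scale /=; ring.
  have := haar_stein dX (bmeasX _ b1) (bmeasM (bmeas_cst _ _) (bmeasX _ b1)).
  by move=> <-; apply: eq_Rintegral => g _; ring.
have ef : \int[P]_g (2 * n%:R + (- 2) * p 4 g + n%:R * p 2 g
    + (- 1) * (p 1 g ^+ 2 * p 2 g) + (- M) * (p 2 g ^+ 2)) = 0.
  have := haar_ibp2 hP G2 b2 ltac:(by bmeas).
  move=> <-; apply: eq_Rintegral => g _.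
  rewrite -!scalemxAl !mxtraceZ mxtrace_orthX_mul (mxtrace_orthX_tr _ 0 2).
  by rewrite power_trace0 -/(p 2 g); ring.
have eg : \int[P]_g (2 * (p 1 g ^+ 2) + (- 2) * (p 1 g * p 3 g)
    + n%:R * (p 1 g ^+ 2) + (- 1) * (p 1 g ^+ 4)
    + (- M) * (p 1 g ^+ 2 * p 2 g)) = 0.
  have := haar_ibp2 hP (gradientM G1 G1) (bmeasM b1 b1) ltac:(by bmeas).
  move=> <-; apply: eq_Rintegral => g _.
  rewrite !mulmxDl !mxtraceD -!scalemxAl !mxtraceZ !mxtrace_orthX_mul.
  rewrite (mxtrace_orthX_tr' _ 1 1).
  by rewrite -/(p 1 g); ring.
transitivity (\int[P]_g (1 + (- 2) * p 2 g + 1 * (p 2 g ^+ 2))).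
  by apply: eq_Rintegral => g _; ring.
move: ec ed ee ef eg; rewrite !bmeas_RintegralD; [|by bmeas..].
rewrite !bmeas_RintegralZ; [|by bmeas..].
rewrite !probability_Rintegral_cst E11 E2.
move: (\int[P]_x p 4 x) (\int[P]_x (p 1 x * p 3 x)) (\int[P]_x (p 2 x ^+ 2))
  (\int[P]_x (p 1 x ^+ 2 * p 2 x)) (\int[P]_x (p 1 x ^+ 4)).
move=> x4 x13 x22 x112 x1111 ec ed ee ef eg.
have : 3 < M by move: n4; rewrite -(ltr_nat R) => n4; lra.
rewrite (_ : n%:R = M + 1) in ec ed ee ef eg *; last by ring.
rewrite addrK in ec ed ee ef eg.
move: M ec ed ee ef eg => m ec ed ee ef eg m3.
(* Subtracting [eg] from [ed] gives this; comparing [ee] with [ef] then gives [da]. *)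
have ce : x22 = x1111 by lra.
have da : x4 = x112 by subst x1111; lra.
(* Multiplying [ed] by m allows m [x13] to be replaced by [ec] and m [x22] by [ee], leaving [x112]
   alone. The factor 9 - m^2 is nonzero because m = n - 1 > 3. *)
have : (9 - m ^+ 2) * (x112 - 1) = 0.
  have h1 : m * (2 * 1 + -2 * x13 + (m + 1) * 1 + -1 * x22 + - m * x112) = 0.
    by rewrite ed mulr0.
  by subst x4; nra.
move/eqP; rewrite mulf_eq0 lt_eqF/=; last by nra.
rewrite subr_eq0 => /eqP d1; subst x112.
have /eqP : m * (x22 - 3) = 0 by lra.
rewrite mulf_eq0 gt_eqF/=; last by lra.
by rewrite subr_eq0 => /eqP ->; ring.
Qed.

End haar_moments.

(** * Stein's equation *)

(** A quadratic remainder bound covers the kink of the squared positive part, where it can be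
    checked by signs alone. *)
Lemma is_derive_quadratic (R : realType) (f : R -> R) (x d : R) :
  (forall h, `|f (h + x) - f x - d * h| <= h ^+ 2) -> is_derive x 1 f d.
Proof.
move=> fq.
have fd : h^-1 *: ((f \o shift x) (h *: (1 : R)) - f x) @[h --> 0^'] --> d.
  apply/cvgrPdist_le => e e0; near=> h.
  have h0 : h != 0 by near: h; exact: nbhs_dnbhs_neq.
  have he : `|h| <= e.
    by near: h; apply: dnbhs0_le.
  apply: le_trans he.
  rewrite /= /shift /= [h *: 1]mulr1 distrC.
  rewrite (_ : h^-1 *: _ - d = h^-1 * (f (h + x) - f x - d * h)); last first.
    by rewrite mulrBr [h^-1 * (d * h)]mulrCA mulVf// mulr1.
  rewrite normrM normfV ler_pdivrMl ?normr_gt0// (le_trans (fq h))//.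
  by rewrite -normrM -expr2 ler_norm.
split; first by apply: cvgP fd.
exact: cvg_lim fd.
Unshelve. all: by end_near. Qed.

Lemma is_derive_maxr0_sqr (R : realType) (x : R) :
  is_derive x 1 (fun x => Num.max x 0 ^+ 2) (2 * Num.max x 0).
Proof.
apply: is_derive_quadratic => h; rewrite ler_norml /Num.max.
by case: ltP => hx; case: ltP => x0; apply/andP; split; nra.
Qed.

(** * The standard normal density and distribution function *)

Section gauss.
Context (R : realType).
Implicit Types x : R.

Definition gauss_pdf x : R := (Num.sqrt (2 * pi))^-1 * expR (- (x ^+ 2 / 2)).
Definition gauss_cdf x : R := \int[lebesgue_measure]_(t in `]-oo, x]) gauss_pdf t.

Lemma gauss_pdfE : gauss_pdf = normal_pdf 0 1.
Proof.
apply/funext => x; rewrite normal_pdfE ?oner_neq0// /gauss_pdf.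
rewrite /normal_peak /normal_fun subr0 expr1n mul1r mulr_natl.
by rewrite mulNr.
Qed.

Lemma gauss_pdf_gt0 x : 0 < gauss_pdf x.
Proof. by rewrite mulr_gt0 ?expR_gt0// invr_gt0 sqrtr_gt0 mulr_gt0// pi_gt0. Qed.

Lemma is_derive_gauss_pdf x : is_derive x 1 gauss_pdf (- x * gauss_pdf x).
Proof.
rewrite /gauss_pdf; apply: is_derive_eq.
rewrite /GRing.scale /=; move: (Num.sqrt _)^-1 (expR _) => a b; by field.
Qed.

Lemma continuous_gauss_pdf : continuous gauss_pdf.
Proof. by rewrite gauss_pdfE; apply: continuous_normal_pdf; exact: oner_neq0. Qed.

Lemma integrable_gauss_pdf (D : set R) : measurable D ->
  lebesgue_measure.-integrable D (EFin \o gauss_pdf).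
Proof.
move=> mD; rewrite gauss_pdfE.
by apply: (integrableS measurableT) => //; exact: integrable_normal_pdf.
Qed.

Lemma is_derive_gauss_cdf x : is_derive x 1 gauss_cdf (gauss_pdf x).
Proof.
have xx1 : x < x + 1 by rewrite ltrDl.
have nx : ((-oo%O : itv_bound R) < BRight x)%E by rewrite ltNyr.
have [d <-] := continuous_FTC1 xx1 (integrable_gauss_pdf (measurable_itv _))
  nx (@continuous_gauss_pdf x).
by split => //; rewrite derive1E.
Qed.

Lemma gauss_cdf_normal x : gauss_cdf x = fine (normal_prob 0 1 `]-oo, x]).
Proof. by rewrite /gauss_cdf gauss_pdfE. Qed.

(** The identity as a random variable: its [cdf] under the normal law is [gauss_cdf], which thus
    inherits the limits at both infinities. *)
Let idR : measurableTypeR R -> R := idfun.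
#[local] HB.instance Definition _ :=
  @isMeasurableFun.Build _ _ _ _ idR (@measurable_id _ _ setT).

Lemma gauss_cdf_cdf x :
  gauss_cdf x = fine (cdf (idR : {RV (normal_prob 0 1 : probability _ R) >-> R}) x).
Proof. by rewrite gauss_cdf_normal. Qed.

Lemma cvg_gauss_cdfNy : gauss_cdf x @[x --> -oo] --> (0 : R).
Proof.
rewrite (_ : gauss_cdf = fun x =>
    fine (cdf (idR : {RV (normal_prob 0 1 : probability _ R) >-> R}) x)).
  by apply: fine_cvg; exact: cvg_cdfNy0.
by apply/funext => x; exact: gauss_cdf_cdf.
Qed.

Lemma cvg_gauss_cdfy : gauss_cdf x @[x --> +oo] --> (1 : R).
Proof.
rewrite (_ : gauss_cdf = fun x =>
    fine (cdf (idR : {RV (normal_prob 0 1 : probability _ R) >-> R}) x)).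
  by apply: fine_cvg; exact: cvg_cdfy1.
by apply/funext => x; exact: gauss_cdf_cdf.
Qed.

End gauss.

(** * Solution of Stein's equation and a bound on its derivative *)

Section stein.
Context (R : realType).
Implicit Types (x a : R) (G k : R -> R).

(** With the factor a frozen, u = [gauss_pdf] - a G has derivative -(x + a k) [gauss_pdf], which is
    nonpositive for x >= a >= 0. If u(a) < 0, then u stays below u(a) on the right of a,
    contradicting a G -> 0 and [gauss_pdf] > 0. *)
Lemma mills_ratio_bound1 G k :
  (forall x, is_derive x 1 G (k x * gauss_pdf x)) -> (forall x, -1 <= k x) ->
  G x @[x --> +oo] --> 0 -> forall a, 0 <= a -> a * G a <= gauss_pdf a.
Proof.
move=> dG k1 G0 a a0; rewrite leNgt; apply/negP => ua.
pose u x := gauss_pdf x - a * G x.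
have du x : is_derive x 1 u (- x * gauss_pdf x - a * (k x * gauss_pdf x)).
  have d1 := is_derive_gauss_pdf x; have d2 := dG x.
  have d3 : is_derive x 1 (fun x => a * G x) (a * (k x * gauss_pdf x)).
    by apply: is_derive_eq; rewrite /GRing.scale /=; ring.
  exact: is_deriveB.
have ule b : a <= b -> u b <= u a.
  move=> ab; rewrite -subr_le0.
  have [|c /andP[/= ac cb] ->] := MVT_segment ab (fun x _ => du x).
    by apply: derivable_within_continuous => x _; case: (du x).
  rewrite mulr_le0_ge0 ?subr_ge0//.
  have -> : - c * gauss_pdf c - a * (k c * gauss_pdf c) =
      - (c + a * k c) * gauss_pdf c by ring.
  rewrite mulr_le0_ge0 ?(ltW (gauss_pdf_gt0 _))// oppr_le0.
  by have := k1 c; rewrite bnd_simp in ac; nra.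
have aG0 : a * G x @[x --> +oo] --> 0.
  by rewrite -(mulr0 a); exact: cvgM (cvg_cst a) G0.
have ua0 : 0 < - u a by rewrite oppr_gt0 subr_lt0.
have [b [ab Gb]] := filter_ex (filterI (nbhs_pinfty_ge (num_real a))
  (cvgr_lt _ aG0 _ ua0)).
have := ule b ab; have := gauss_pdf_gt0 b; rewrite /u in Gb *; lra.
Qed.

Lemma gauss_pdfN x : gauss_pdf (- x) = gauss_pdf x.
Proof. by rewrite /gauss_pdf sqrrN. Qed.

(** The one-sided bound is applied to G and -G, and for negative a to the reflection x -> G(-x). *)
Lemma mills_ratio_bound G k :
  (forall x, is_derive x 1 G (k x * gauss_pdf x)) -> (forall x, `|k x| <= 1) ->
  G x @[x --> +oo] --> 0 -> G x @[x --> -oo] --> 0 ->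
  forall a, `|a * G a| <= gauss_pdf a.
Proof.
move=> dG k1 Gy GNy.
have pos H h : (forall x, is_derive x 1 H (h x * gauss_pdf x)) ->
    (forall x, `|h x| <= 1) -> H x @[x --> +oo] --> 0 ->
    forall a, 0 <= a -> `|a * H a| <= gauss_pdf a.
  move=> dH h1 H0 a a0; rewrite ler_norml lerNl -mulrN; apply/andP; split.
    apply: (@mills_ratio_bound1 (\- H) (fun x => - h x)) => //.
    - by move=> x; have := dH x => d; apply: is_derive_eq; rewrite mulNr.
    - by move=> x; have := h1 x; rewrite ler_norml; lra.
    - by rewrite -oppr0; apply: cvgN.
  apply: (mills_ratio_bound1 dH) => // x.
  by have := h1 x; rewrite ler_norml => /andP[].
move=> a; have [a0|/ltW a0] := leP 0 a; first exact: pos dG k1 Gy a a0.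
rewrite -gauss_pdfN -normrN -mulNr.
have := pos (G \o -%R) (fun x => - k (- x)) _ _ _ (- a).
rewrite /= opprK; apply => //; last by rewrite oppr_ge0.
- move=> x; apply: (is_derive_eq (is_derive1_comp (dG (- x)) (is_deriveNid x 1))).
  by rewrite gauss_pdfN; ring.
- by move=> x; rewrite normrN.
- by move/cvgNy_compNP : GNy.
Qed.

(** The test function is h = [theta' \o gauss_cdf]. As [gauss_cdf] sends a standard normal Z to a
    uniform variable, E[h(Z)] is [theta 1 - theta 0], and no Gaussian integral of h has to be
    computed. *)
Lemma stein_solution (theta theta' : R -> R) :
  (forall u : R, is_derive u 1 theta (theta' u)) ->
  (forall u, 0 <= theta' u <= 1) ->
  exists f f' : R -> R, [/\ forall x : R, is_derive x 1 f (f' x),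
    forall x, f' x - x * f x = theta' (gauss_cdf x) - (theta 1 - theta 0) &
    forall x, `|f' x| <= 2].
Proof.
move=> dt t01.
pose c := theta 1 - theta 0.
have c01 : 0 <= c <= 1.
  rewrite /c; have [|b _ ->] := @MVT_segment R theta theta' 0 1 ler01 (fun x _ => dt x).
    by apply: derivable_within_continuous => x _; case: (dt x).
  by rewrite subr0 mulr1.
pose k x := theta' (gauss_cdf x) - c.
have k1 x : `|k x| <= 1.
  have := t01 (gauss_cdf x); rewrite ler_norml /k; lra.
(* A primitive of (h - c) [gauss_pdf] that vanishes at both infinities. *)
pose G x := theta (gauss_cdf x) - theta 0 - c * gauss_cdf x.
have dG x : is_derive x 1 G (k x * gauss_pdf x).
  have d1 := is_derive_gauss_cdf x.
  have d2 := @is_derive1_comp _ _ _ x _ _ (dt (gauss_cdf x)) d1.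
  rewrite /G /k; apply: is_derive_eq.
  by rewrite /GRing.scale /=; ring.
have ct := is_derive_continuous dt.
have Gy : G x @[x --> +oo] --> 0.
  rewrite -[X in _ --> X](_ : theta 1 - theta 0 - c * 1 = 0); last by rewrite /c; ring.
  apply: cvgB; last exact: (cvgM (cvg_cst c) (@cvg_gauss_cdfy R)).
  apply: cvgB; last exact: cvg_cst.
  exact: (cvg_comp _ _ (@cvg_gauss_cdfy R) (ct 1)).
have GNy : G x @[x --> -oo] --> 0.
  rewrite -[X in _ --> X](_ : theta 0 - theta 0 - c * 0 = 0); last by rewrite /c; ring.
  apply: cvgB; last exact: (cvgM (cvg_cst c) (@cvg_gauss_cdfNy R)).
  apply: cvgB; last exact: cvg_cst.
  exact: (cvg_comp _ _ (@cvg_gauss_cdfNy R) (ct 0)).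
have xG := mills_ratio_bound dG k1 Gy GNy.
(* [E] is the inverse of [gauss_pdf], so [G x * E x] is the classical Stein solution. Its derivative
   is [k x] plus x f(x), each at most 1 in absolute value. *)
pose E x := Num.sqrt (2 * pi) * expR (x ^+ 2 / 2) : R.
have E0 x : 0 < E x.
  by rewrite mulr_gt0 ?expR_gt0// sqrtr_gt0 mulr_gt0// pi_gt0.
have pE x : gauss_pdf x * E x = 1.
  rewrite /gauss_pdf /E expRN mulrACA mulVf ?mulVf ?mul1r//.
    by rewrite gt_eqF// expR_gt0.
  by rewrite gt_eqF// sqrtr_gt0 mulr_gt0// pi_gt0.
have dE x : is_derive x 1 E (x * E x).
  rewrite /E; apply: is_derive_eq.
  by rewrite /GRing.scale /=; move: (Num.sqrt _) (expR _) => a b; by field.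
exists (fun x => G x * E x), (fun x => k x + x * (G x * E x)); split.
- move=> x; have d1 := dG x; have d2 := dE x.
  apply: is_derive_eq; rewrite /GRing.scale /=.
  rewrite -[k x in RHS]mulr1 -(pE x); ring.
- by move=> x; rewrite addrK.
- move=> x; apply: (le_trans (ler_normD _ _)).
  apply: lerD => //; rewrite mulrA normrM (gtr0_norm (E0 x)) -(pE x).
  by rewrite ler_pM2r.
Qed.

End stein.

(** * Normal approximation *)

Section normal_approximation.
Context (R : realType) (n : nat).
Variable P : probability (orthogonal_group R n) R.
Hypothesis hP : is_haar P.

Lemma haar_trace_normal (theta theta' : R -> R) : (4 < n)%N ->
  (forall u : R, is_derive u 1 theta (theta' u)) ->
  (forall u, 0 <= theta' u <= 1) -> measurable_fun setT theta' ->
  `| \int[P]_g theta' (gauss_cdf (p 1 g)) - (theta 1 - theta 0) |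
  <= 2 * Num.sqrt 2 / (n%:R - 1).
Proof.
move=> n4 dt t01 mt.
have [f [f' [df fE f'2]]] := stein_solution dt t01.
set c := theta 1 - theta 0 in fE *.
have b1 := @bmeas_p R n 1; have b2 := @bmeas_p R n 2.
have [m1 [C hC]] := b1.
have mf := continuous_measurable_fun (is_derive_continuous df).
have mPhi := continuous_measurable_fun (is_derive_continuous (@is_derive_gauss_cdf R)).
have mtPhi : measurable_fun setT (fun x => theta' (gauss_cdf x)).
  exact: measurableT_comp.
(* Stein's equation expresses [f'] through functions already known to be measurable. *)
have mf' : measurable_fun setT f'.
  rewrite (_ : f' = fun x => x * f x + (theta' (gauss_cdf x) - c)).
    by apply: measurable_funD; [exact: measurable_funM|exact: measurable_funB].
  by apply/funext => x; rewrite -fE; ring.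
have bf : bounded_measurable (fun g : orthogonal_group R n => f (p 1 g)).
  split; first exact: measurableT_comp mf m1.
  (* The bound on [f'] makes [f] 2-Lipschitz, and the trace is bounded by [C]. *)
  exists (`|f 0| + 2 * C) => g.
  rewrite -[f (p 1 g)](subrK (f 0)) addrC (le_trans (ler_normD _ _))// lerD2l.
  by rewrite (le_trans (is_derive_lipschitz df f'2 _ _))// subr0 ler_pM2l.
have bf' : bounded_measurable (fun g : orthogonal_group R n => f' (p 1 g)).
  by split; [exact: measurableT_comp mf' m1|exists 2].
have bt : bounded_measurable
    (fun g : orthogonal_group R n => theta' (gauss_cdf (p 1 g))).
  split; first exact: measurableT_comp mtPhi m1.
  by exists 1 => g; have := t01 (gauss_cdf (p 1 g)); rewrite ler_norml; lra.
have M0 : 0 < n%:R - 1 :> R by move: n4; rewrite -(ltr_nat R); lra.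
(* Stein's equation turns the left side into (n - 1) E[f'(p_1) - p_1 f(p_1)]; adding the null
   integral of [haar_stein] removes f and leaves p_2 - 1. *)
have E : (n%:R - 1) * (\int[P]_g theta' (gauss_cdf (p 1 g)) - c) =
    \int[P]_g (f' (p 1 g) * (p 2 g - 1)).
  rewrite -[c in LHS](probability_Rintegral_cst P) -bmeas_RintegralB; [|by bmeas..].
  rewrite -bmeas_RintegralZ; last by bmeas.
  rewrite -[RHS]addr0 -(haar_stein hP df bf bf') -bmeas_RintegralD; [|by bmeas..].
  apply: eq_Rintegral => g _; rewrite -fE; ring.
rewrite ler_pdivlMr// mulrC -(gtr0_norm M0) -normrM E.
have s0 : 0 < Num.sqrt 2 :> R by rewrite sqrtr_gt0.
have s2 : Num.sqrt 2 ^+ 2 = 2 :> R by rewrite sqr_sqrtr.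
(* A pointwise majorant replaces the Cauchy-Schwarz inequality. As E[(p_2 - 1)^2] = 2, each of its
   two terms has integral sqrt 2. *)
pose B (g : orthogonal_group R n) :=
  (Num.sqrt 2)^-1 * (p 2 g - 1) ^+ 2 + Num.sqrt 2 : R.
have BE : \int[P]_g B g = 2 * Num.sqrt 2.
  rewrite bmeas_RintegralD ?bmeas_RintegralZ; [|by bmeas..].
  rewrite (haar_variance_p2 hP)// probability_Rintegral_cst.
  have i2 : (Num.sqrt 2)^-1 * 2 = Num.sqrt 2 :> R.
    by rewrite -[X in _ * X]s2 expr2 mulKf ?gt_eqF.
  by rewrite i2; ring.
have hB g : `|f' (p 1 g) * (p 2 g - 1)| <= B g.
  (* AM-GM: [2 |y| <= y^2 / sqrt 2 + sqrt 2] *)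
  apply: (@le_trans _ _ (2 * `|p 2 g - 1|)); first by rewrite normrM ler_wpM2r.
  rewrite /B -(real_normK (num_real (p 2 g - 1))).
  move: `|p 2 g - 1| => y.
  have -> : (Num.sqrt 2)^-1 * y ^+ 2 + Num.sqrt 2 =
    2 * y + (Num.sqrt 2)^-1 * (y - Num.sqrt 2) ^+ 2 :> R.
    by field; rewrite gt_eqF.
  by rewrite lerDl mulr_ge0 ?sqr_ge0// invr_ge0 ltW.
rewrite -BE ler_norml; apply/andP; split.
  rewrite -[leLHS]mulN1r -bmeas_RintegralZ; last by rewrite /B; bmeas.
  apply: bmeas_le_Rintegral; [by bmeas..|] => g.
  by have := hB g; rewrite ler_norml => /andP[h _]; rewrite mulN1r.
apply: bmeas_le_Rintegral; [by bmeas..|] => g.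
by have := hB g; rewrite ler_norml => /andP[].
Qed.

End normal_approximation.

(** * Continuous approximation of indicators *)

Section spline.
Context (R : realType) (u0 d : R).
Implicit Type u : R.
Local Notation pos u := (Num.max u 0).

(* The C^1 primitive of the ramp that falls from 1 to 0 between [u0] and [u0 + d]. *)
Definition spline u : R := u - (pos (u - u0) ^+ 2 - pos (u - (u0 + d)) ^+ 2) / (2 * d).
Definition ramp u : R := 1 - (pos (u - u0) - pos (u - (u0 + d))) / d.

Lemma is_derive_spline u (d0 : 0 < d) : is_derive u 1 spline (ramp u).
Proof.
have dp a : is_derive u 1 (fun u => pos (u - a) ^+ 2) (2 * pos (u - a)).
  have da : is_derive u 1 (fun u => u - a) 1.
    by apply: is_derive_eq; rewrite subr0.
  have := @is_derive1_comp R (fun v => pos v ^+ 2) (fun u => u - a) u _ _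
    (is_derive_maxr0_sqr (u - a)) da.
  by rewrite mulr1.
have d1 := dp u0; have d2 := dp (u0 + d).
rewrite /spline /ramp; apply: is_derive_eq.
by rewrite /GRing.scale /=; field; rewrite gt_eqF.
Qed.

Lemma ramp_itv u (d0 : 0 < d) : 0 <= ramp u <= 1.
Proof.
rewrite /ramp subr_ge0 ler_pdivrMr// mul1r gerBl divr_ge0 ?(ltW d0)//.
  by rewrite andbT /Num.max; do 2 case: ltP => ?; lra.
by rewrite /Num.max; do 2 case: ltP => ?; lra.
Qed.

Lemma ramp1 u (d0 : 0 < d) : u <= u0 -> ramp u = 1.
Proof.
move=> uu0; rewrite /ramp !max_r; [by rewrite subrr mul0r subr0|lra|lra].
Qed.

Lemma ramp0 u (d0 : 0 < d) : u0 + d <= u -> ramp u = 0.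
Proof.
move=> uu0; rewrite /ramp !max_l; [|lra|lra].
by field; rewrite gt_eqF.
Qed.

Lemma measurable_ramp : measurable_fun setT ramp.
Proof.
apply: measurable_funB => //; apply: measurable_funM => //.
by apply: measurable_funB; apply: measurable_maxr => //; exact: measurable_funB.
Qed.

(** [spline] is the identity up to [u0] and the constant u0 + d/2 beyond [u0 + d]. This bound and
    [spline_ge] locate its increment over [0, 1] even when the ramp leaves that interval. *)
Lemma spline_le u (d0 : 0 < d) : spline u <= Num.min u (u0 + d).
Proof.
rewrite /spline lerBlDr -lerBlDl ler_pdivlMr ?mulr_gt0//.
by rewrite /Num.min /Num.max; do 3 case: ltP => ?; nra.
Qed.

Lemma spline_ge u (d0 : 0 < d) : Num.min u u0 <= spline u.
Proof.
rewrite /spline lerBrDr -lerBrDl ler_pdivrMr ?mulr_gt0//.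
by rewrite /Num.min /Num.max; do 3 case: ltP => ?; nra.
Qed.

End spline.

(** * From ramps to the Kolmogorov distance *)

Lemma gauss_cdf_itv (R : realType) (x : R) : 0 <= gauss_cdf x <= 1.
Proof.
rewrite gauss_cdf_normal; apply/andP; split; first exact: fine_ge0.
rewrite -lee_fin fineK ?probability_le1//; exact: fin_num_measure.
Qed.

Lemma gauss_cdf_homo (R : realType) : {homo @gauss_cdf R : x y / x <= y}.
Proof.
move=> x y xy; rewrite !gauss_cdf_normal fine_le ?fin_num_measure//.
by rewrite le_measure ?inE//; exact: subitvPr.
Qed.

Lemma measurable_orth_trace_le (R : realType) (n : nat) (x : R) :
  measurable [set g : orthogonal_group R n | \tr (orth_mx g) <= x].
Proof.
have := @measurable_orth_trace R n measurableT _ (measurable_itv `]-oo, x]).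
by rewrite setTI; congr measurable; apply/seteqP; split => g /=; rewrite in_itv.
Qed.

(** The indicator of {tr g <= x0} is squeezed between two ramps of [gauss_cdf] of the trace. The
    estimate of [haar_trace_normal] does not depend on the steepness of the ramp, so the width d can
    be taken arbitrarily small. *)
Lemma haar_trace_kolmogorov (R : realType) (n : nat)
    (P : probability (orthogonal_group R n) R) (hP : is_haar P) (x0 : R) :
  (4 < n)%N ->
  `| fine (P [set g : orthogonal_group R n | \tr (orth_mx g) <= x0]) - gauss_cdf x0 |
  <= 2 * Num.sqrt 2 / (n%:R - 1).
Proof.
move=> n4; set A := [set g | _]; set B := 2 * _ / _.
have mA : measurable A by exact: measurable_orth_trace_le.
have bA : bounded_measurable (\1_A : orthogonal_group R n -> R).
  split; first exact: measurable_indic.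
  by exists 1 => g; rewrite indicE ger0_norm// lern1 leq_b1.
have -> : fine (P A) = \int[P]_g \1_A g by rewrite /Rintegral integral_indic// setIT.
have p1E (g : orthogonal_group R n) : p 1 g = \tr (orth_mx g).
  by rewrite /power_trace expr1.
have [u00 u01] := andP (gauss_cdf_itv x0).
have bt u0 d : 0 < d ->
    bounded_measurable (fun g : orthogonal_group R n => ramp u0 d (gauss_cdf (p 1 g))).
  move=> d0; split; last first.
    exists 1 => g; have := ramp_itv u0 (gauss_cdf (p 1 g)) d0.
    by rewrite ler_norml; lra.
  have [m1 _] := @bmeas_p R n 1; apply: measurableT_comp; first exact: measurable_ramp.
  apply: measurableT_comp m1; apply: continuous_measurable_fun.
  exact: is_derive_continuous (@is_derive_gauss_cdf R).
have key u0 d (d0 : 0 < d) := haar_trace_normal hP n4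
  (fun u => is_derive_spline u0 u d0) (fun u => ramp_itv u0 u d0)
  (measurable_ramp u0 d).
rewrite ler_norml; apply/andP; split; apply/ler_addgt0Pr => d d0.
  (* The lower ramp reaches 0 at [gauss_cdf x0], so it vanishes wherever the trace exceeds x0. *)
  have := key (gauss_cdf x0 - d) d d0; rewrite -/B ler_norml => /andP[h _].
  have s1 := spline_ge (gauss_cdf x0 - d) 1 d0.
  have s0 := spline_le (gauss_cdf x0 - d) 0 d0.
  rewrite subrK min_l// in s0; rewrite min_r in s1; last by lra.
  have le : \int[P]_g ramp (gauss_cdf x0 - d) d (gauss_cdf (p 1 g)) <= \int[P]_g \1_A g.
    apply: bmeas_le_Rintegral => // [|g]; first exact: bt.
    rewrite indicE; have [_|/negP gA] := boolP (g \in A).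
      by have /andP[] := ramp_itv (gauss_cdf x0 - d) (gauss_cdf (p 1 g)) d0.
    rewrite ramp0// subrK p1E gauss_cdf_homo// ltW// ltNge; apply/negP => gx.
    by apply: gA; rewrite inE.
  lra.
(* The upper ramp starts its descent at [gauss_cdf x0], so it equals 1 wherever the trace is at most
   x0. *)
have := key (gauss_cdf x0) d d0; rewrite -/B ler_norml => /andP[_ h].
have s1 := spline_le (gauss_cdf x0) 1 d0.
have s0 := spline_ge (gauss_cdf x0) 0 d0.
rewrite min_l// in s0.
have s1' : spline (gauss_cdf x0) d 1 <= gauss_cdf x0 + d.
  by apply: (le_trans s1); rewrite ge_min lexx orbT.
have le : \int[P]_g \1_A g <= \int[P]_g ramp (gauss_cdf x0) d (gauss_cdf (p 1 g)).
  apply: bmeas_le_Rintegral => // [|g]; first exact: bt.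
  rewrite indicE; have [|_] := boolP (g \in A).
    by rewrite inE /A /= => gA; rewrite ramp1// p1E gauss_cdf_homo.
  by have /andP[] := ramp_itv (gauss_cdf x0) (gauss_cdf (p 1 g)) d0.
lra.
Qed.

Theorem theorem3p13 (R : realType) (n : nat) (hn : (2 <= n)%N)
    (P : probability (orthogonal_group R (2 * n)) R) (hP : is_haar P) (x0 : R) :
  `| fine (P [set g : orthogonal_group R (2 * n) | \tr (orth_mx g) <= x0])
     - (Num.sqrt (2 * pi))^-1 *
       (\int[lebesgue_measure]_(x in `]-oo, x0]) expR (- (x ^+ 2 / 2))) |
  <= Num.sqrt 2 / (n%:R - 1).
Proof.
have -> : (Num.sqrt (2 * pi))^-1 *
    (\int[lebesgue_measure]_(x in `]-oo, x0]) expR (- (x ^+ 2 / 2))) =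
    gauss_cdf x0 :> R.
  rewrite /gauss_cdf /gauss_pdf RintegralZl//.
  have ip := integrable_gauss_pdf (measurable_itv `]-oo, x0]).
  (* The exponential is integrable as a constant multiple of the density. *)
  have : lebesgue_measure.-integrable `]-oo, x0]
      (fun x => (Num.sqrt (2 * pi))%:E * (EFin \o @gauss_pdf R) x)%E.
    by apply: integrableZl => //; exact: measurable_itv.
  apply: eq_integrable => // x _; rewrite /= -EFinM /gauss_pdf mulVKf//.
  by rewrite gt_eqF// sqrtr_gt0 mulr_gt0// pi_gt0.
have s0 : 0 < Num.sqrt 2 :> R by rewrite sqrtr_gt0.
have s2 : Num.sqrt 2 ^+ 2 = 2 :> R by rewrite sqr_sqrtr.
have M0 : 0 < n%:R - 1 :> R by rewrite subr_gt0 ltr1n.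
(* For n >= 3 the dimension 2n exceeds 4, and 2/(2n - 1) <= 1/(n - 1). For n = 2 the bound is sqrt
   2, and two numbers in [0, 1] differ by at most 1. *)
case: (ltnP 2 n) => n3.
  apply: le_trans (haar_trace_kolmogorov hP x0 _) _; first by lia.
  rewrite ler_pdivrMr; last by rewrite natrM; lra.
  rewrite mulrAC ler_pdivlMr// natrM.
  nra.
have [u00 u01] := andP (gauss_cdf_itv x0).
have M1 : n%:R - 1 <= 1 :> R by rewrite lerBlDr -(natrD R 1 1) ler_nat.
set A := [set g | _].
have P0 : 0 <= fine (P A) by exact: fine_ge0.
have mA : measurable A by exact: measurable_orth_trace_le.
have P1 : fine (P A) <= 1.
  by rewrite -lee_fin fineK ?probability_le1//; exact: fin_num_measure.
apply: (@le_trans _ _ 1); first by rewrite ler_norml; lra.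
by rewrite ler_pdivlMr// mul1r; nra.
Qed.
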